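(* Let $X$ be a proper, uniquely geodesic, straight metric space, let $b\in X$ be a basepoint, and let $\gamma\in D_b$ be a geodesic ray starting at $b$. For any $\xi\in\Pi^{-1}(\gamma)$ there exists a continuous path from $B(\gamma)$ to $\xi$ contained in $\Pi^{-1}(\gamma)$.
   Context: A geodesic in $(X,d)$ is a map $\gamma:I\to X$ from an interval with $d(\gamma(t),\gamma(s))=|t-s|$. $X$ is proper if closed balls are compact; uniquely geodesic if any two distinct points are joined by a unique geodesic; straight if every geodesic segment is contained in a unique bi-infinite geodesic. $D_b$ is the set of geodesic rays $[0,\infty)\to X$ starting at $b$. Horofunction compactification: $h:X\to C(X)$, $h(x)(\cdot)=d(x,\cdot)-d(x,b)$, with $C(X)$ (continuous real functions) given the topology of uniform convergence on compact sets; $h$ is an embedding, $\overline{X}^h=\overline{h(X)}$ is compact, and $\partial\overline{X}^h=\overline{X}^h\setminus h(X)$. For $\gamma\in D_b$, $B(\gamma)=\lim_{t\to\infty}h(\gamma(t))\in\partial\overline{X}^h$. For $\xi\in\partial\overline{X}^h$, $\Pi(\xi)\in D_b$ is the unique geodesic ray from $b$ whose bi-infinite extension $\gamma$ satisfies $\xi(\gamma(t))-\xi(\gamma(0))=-t$ for all $t\in\mathbb{R}$; for $x\in X$, $\Pi(h(x))=x$. $\Pi^{-1}(\gamma)\subset\partial\overline{X}^h$ is the fiber over $\gamma$. *)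

(* Defs.v *)
From HB Require Import structures.
From mathcomp Require Import all_boot all_order all_algebra.
From mathcomp Require Import all_classical all_reals all_analysis.

Set Implicit Arguments.
Unset Strict Implicit.
Unset Printing Implicit Defensive.

Import Order.TTheory GRing.Theory Num.Theory.
Import numFieldNormedType.Exports.

Local Open Scope classical_set_scope.
Local Open Scope ring_scope.

(* A geodesic with domain the interval I is represented by a total function
   R -> X whose values outside I are irrelevant; accordingly two geodesics with
   domain I are identified when they agree on I. *)
Section Geodesics.
Context {R : realType} {X : metricType R}.

Definition geodesic (I : interval R) (g : R -> X) : Prop :=
  {in I &, forall s t, mdist (g s) (g t) = `|s - t|}.

Definition geodesic_line (g : R -> X) : Prop := geodesic `]-oo, +oo[ g.

Definition geodesic_ray (b : X) (g : R -> X) : Prop :=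
  geodesic `[0, +oo[ g /\ g 0 = b.

Definition geodesic_between (x y : X) (g : R -> X) : Prop :=
  [/\ geodesic `[0, mdist x y] g, g 0 = x & g (mdist x y) = y].

End Geodesics.

(* Closed balls are {y | d(x, y) <= r}; the library's [closed_ball], the closure
   of the open ball, may be smaller in a general metric space. *)
Definition proper_space (R : realType) (X : metricType R) : Prop :=
  forall (x : X) (r : R), compact [set y : X | mdist x y <= r].

Definition uniquely_geodesic (R : realType) (X : metricType R) : Prop :=
  forall x y : X, x != y ->
    exists2 g, geodesic_between x y g &
      forall g', geodesic_between x y g' -> {in `[0, mdist x y], g =1 g'}.

(* Segments are non-degenerate. Containment is expressed with parametrizations:
   a line containing the image of a segment can be reparametrized, in exactly
   one way, so as to extend it. *)
Definition straight (R : realType) (X : metricType R) : Prop :=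
  forall (s t : R) (g : R -> X), s < t -> geodesic `[s, t] g ->
    exists! l : R -> X, geodesic_line l /\ {in `[s, t], l =1 g}.

Section ContinuousFunctions.
Context {R : realType} (X : metricType R).

(* Continuous real functions, with uniform convergence on compact sets. *)
Definition CX : Type := continuousType X R.

HB.instance Definition _ := Choice.on CX.
HB.instance Definition _ := Uniform.copy CX
  (initial_topology (id : continuousType X R -> {family compact, X -> R})).
HB.instance Definition _ := isPointed.Build CX (cst 0 : continuousType X R).

Definition CX_fun (f : CX) : X -> R := (f : continuousType X R).

End ContinuousFunctions.

Coercion CX_fun : CX >-> Funclass.

Section Horofunctions.
Context {R : realType} {X : metricType R} (b : X).

Definition horo_fun (x y : X) : R := mdist x y - mdist x b.

Lemma horo_fun_continuous (x : X) : continuous (horo_fun x).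
Proof.
move=> y; apply/cvgrPdist_lt => e e0.
apply: filterS (nbhsx_ballx y e e0) => z.
rewrite ballEmdist /= /horo_fun opprB addrA subrK => yz.
apply: le_lt_trans yz.
have h1 := metric_triangle x z y; have h2 := metric_triangle x y z.
rewrite (metric_sym z y) in h1.
by rewrite ler_distl; apply/andP; split; rewrite ?lerBlDr.
Qed.

Definition horo (x : X) : CX X :=
  (mkcts (@horo_fun_continuous x) : continuousType X R).

Definition horo_compactification : set (CX X) := closure (range horo).

Definition horo_boundary : set (CX X) := horo_compactification `\` range horo.

Definition busemann (g : R -> X) : CX X := lim (horo (g t) @[t --> +oo]).

Definition directed_by (xi : CX X) (g : R -> X) : Prop :=
  geodesic_ray b g /\
  exists l : R -> X, [/\ geodesic_line l, {in `[0, +oo[, l =1 g} &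
    forall t : R, xi (l t) - xi (l 0) = - t].

(* When X is proper, uniquely geodesic and straight, each xi in [horo_boundary]
   has exactly one ray g (up to its values at t < 0) with [directed_by xi g].
   The default value of [xget] is a constant map, hence never a geodesic ray. *)
Definition Pi (xi : CX X) : R -> X := xget (fun=> b) [set g | directed_by xi g].

Definition Pi_fiber (g : R -> X) : set (CX X) :=
  [set xi | horo_boundary xi /\ {in `[0, +oo[, Pi xi =1 g}].

End Horofunctions.

(* Main.v *)
Require Import Defs.
From HB Require Import structures.
From mathcomp Require Import all_boot all_order all_algebra.
From mathcomp Require Import all_classical all_reals all_analysis.
From mathcomp Require Import lra.

(** Write h x for [horo b x]. Along a geodesic g issued from b the functions
    h (g s) decrease pointwise as s grows: this is the triangle inequality
    ([horo_geodesic_le]). Everything rests on this monotonicity.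

    Write xi as the limit of h x along an ultrafilter F on X, and choose for
    every x a geodesic G x from b to x. Each x gives a decreasing chain
    h (G x s), 0 <= s <= d(b,x), from h b down to h x. The limit of these chains
    along F is a chain of horofunctions ending at xi. Since G x converges to
    gamma pointwise along F ([geodesics_cvg_ray]), every element of the limit
    chain is comparable with every h (gamma s), hence the chain goes down
    through B(gamma) and afterwards stays between xi and B(gamma). That last
    part lies in the fiber: if l is the line extending gamma, then xi and
    B(gamma) are both equal to -t at l t, and so is any function squeezed
    between them; being unbounded below, such a function is not of the form h y.

    The limit chain is turned into a path by parametrizing it with the
    functional [potential] f = sum_k w_k f(z_k), for a dense sequence z and
    positive summable weights. On 1-Lipschitz functions vanishing at b it is
    continuous for pointwise convergence ([cvg_potential]), and it separates
    comparable functions ([potential_inj]). By the intermediate value theorem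
    each chain meets every level v between its two extreme values; eta v is the
    limit along F of the points of level v. For v <= w one has
    w_k (eta w (z_k) - eta v (z_k)) <= potential (eta w) - potential (eta v),
    and the right-hand side is at most w - v, so eta is continuous at every z_k,
    therefore pointwise, therefore in C(X), where pointwise and locally uniform
    convergence of 1-Lipschitz functions agree ([CX_cvg_lip1], [level_path]).

    Straightness enters through [directed_ray_unique]: a line along which a
    1-Lipschitz function decreases at unit speed can be cut at a point and
    continued by any other ray of steepest descent, and the result is again a
    line; since lines do not branch, the two continuations coincide. This shows
    both that G x converges to gamma and that the ray attached to a
    horofunction is unique. *)

Set Implicit Arguments.
Unset Strict Implicit.
Unset Printing Implicit Defensive.

Import Order.TTheory GRing.Theory Num.Theory.
Import numFieldNormedType.Exports.

Local Open Scope classical_set_scope.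
Local Open Scope ring_scope.

(* Keeps [horo b x y] from being unfolded to its definition by simplification. *)
Arguments CX_fun {R X} f _ : simpl never.

(** * Convergence of 1-Lipschitz functions in C(X) *)

Section Topology.
Context {R : realType} {X : metricType R}.

Definition lip1 (f : X -> R) : Prop := forall y z, f y - f z <= mdist y z.

Lemma lip1_norm {f : X -> R} (y z : X) : lip1 f -> `|f y - f z| <= mdist y z.
Proof.
move=> lf; rewrite ler_norml lf andbT.
by have := lf z y; rewrite metric_sym; lra.
Qed.

Lemma nbhs_mdist_lt (x : X) (e : R) : 0 < e -> \forall y \near x, mdist x y < e.
Proof. by move=> e0; have := nbhsx_ballx x e e0; rewrite ballEmdist. Qed.

Lemma lip1_continuous {f : X -> R} : lip1 f -> continuous f.
Proof.
move=> lf x; apply/cvgrPdist_lt => e e0.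
apply: filterS (nbhs_mdist_lt x e0) => y; exact/le_lt_trans/lip1_norm.
Qed.

Definition lip_CX (f : X -> R) (lf : lip1 f) : CX X :=
  (mkcts (lip1_continuous lf) : continuousType X R).

Lemma CX_ext (f g : CX X) : f =1 g -> f = g.
Proof. by move=> fg; apply/continuousEP. Qed.

(** C(X) carries the initial topology for its inclusion in the space of all
    functions with uniform convergence on compact sets, so convergence can be tested
    after the inclusion, one compact set at a time. *)
Lemma CX_cvgP (F : set_system (CX X)) (g : CX X) {FF : Filter F} :
  F --> g <-> forall K : set X, compact K -> forall e : R, 0 < e ->
    F [set f : CX X | forall y, K y -> `|g y - f y| < e].
Proof.
split.
  move=> Fg K cK e e0.
  have /= := fam_nbhs (V := R) (g : {family compact, X -> R}) (entourage_ball _ (PosNum e0)) cK.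
  move=> /(@initial_continuous (continuousType X R) {family compact, X -> R} id g) /Fg.
  exact.
move=> H P /= [_ [[/= B Bop <-] Bg BP]].
have : nbhs (g : {family compact, X -> R}) B by exact: open_nbhs_nbhs.
pose G : set_system (X -> R) := (fun f : CX X => f : X -> R) @ F.
have : {family compact, G --> (g : X -> R)}.
  apply/fam_cvgP => K cK Q /uniform_nbhs [E [entE EQ]].
  move: entE; rewrite -entourage_ballE => -[/= e e0 eE].
  have := H K cK e e0.
  change (F [set f : CX X | forall y, K y -> `|g y - f y| < e] ->
          F [set f : CX X | Q (f : X -> R)]).
  apply: filterS => f fe.
  by apply: EQ => y Ky; apply: eE; exact: fe.
move=> /(_ B) GB Bn; have := GB Bn.
exact: filterS BP.
Qed.

Lemma CX_cvg_pointwise {T} (F : set_system T) (u : T -> CX X) (g : CX X)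
    {FF : Filter F} :
  u @ F --> g -> forall z, u i z @[i --> F] --> g z.
Proof.
move=> /CX_cvgP ug z; apply/cvgrPdist_lt => e e0.
have {}ug : F [set i | forall y, [set z] y -> `|g y - u i y| < e].
  exact: ug (@compact_set1 _ z) e e0.
by apply: filterS ug => i; exact.
Qed.

(** A common Lipschitz constant makes pointwise convergence uniform near each
    point, hence uniform on compact sets. *)
Lemma CX_cvg_lip1 {T} (F : set_system T) (u : T -> CX X) (g : CX X)
    {FF : Filter F} :
  (forall i, lip1 (u i)) -> lip1 g ->
  (forall z, u i z @[i --> F] --> g z) -> u @ F --> g.
Proof.
move=> lu lg ug; apply/CX_cvgP => K cK e e0.
have e3 : 0 < e / 3 by lra.
change (F [set i | K `<=` [set y | `|g y - u i y| < e]]).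
apply: (iffLR (compact_near_coveringP K)) => // x Kx.
exists ([set y | mdist x y < e / 3], [set i | `|g x - u i x| < e / 3]).
  split; first exact: nbhs_mdist_lt.
  by move/cvgrPdist_lt: (ug x); exact.
move=> [y i] /= [xy gi].
have h1 := lip1_norm x y lg; have h2 := lip1_norm x y (lu i).
move: h1 h2 gi; rewrite !ltr_norml !ler_norml.
move=> /andP[a1 a2] /andP[b1 b2] /andP[c1 c2]; apply/andP; split; lra.
Qed.

Lemma CX_hausdorff : hausdorff_space (CX X).
Proof.
move=> f g fg; apply: CX_ext => z.
have [G PG [Gf Gg]] : exists2 G : set_system (CX X), ProperFilter G & G --> f /\ G --> g.
  move: fg; rewrite -[cluster _ _]/(cluster (nbhs f) g) cluster_cvgE.
  by case=> G PG [Gg fG]; exists G.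
have hf : (h z @[h --> G] --> f z) by exact: (@CX_cvg_pointwise _ G id).
have hg : (h z @[h --> G] --> g z) by exact: (@CX_cvg_pointwise _ G id).
exact: etrans (esym (cvg_lim (@Rhausdorff R) hf)) (cvg_lim (@Rhausdorff R) hg).
Qed.

End Topology.

(** * A functional separating comparable functions *)

Section Potential.
Context {R : realType} {X : metricType R}.

(** Each ball of radius n around b is compact, hence has a finite 1/(n+1)-net; z
    enumerates the union of these nets. *)
Lemma proper_dense_seq (b : X) : proper_space X ->
  exists z : nat -> X, forall x (e : R), 0 < e -> exists k, mdist (z k) x < e.
Proof.
move=> pX.
have net (n : nat) : exists s : seq X, forall x, mdist b x <= n%:R ->
    exists2 y, y \in s & mdist y x < n.+1%:R^-1.
  (* Extraction of a finite subcover is stated for pointed spaces; b is the point. *)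
  pose PX := HB.pack_for ptopologicalType X (isPointed.Build X b).
  have : compact ([set y | mdist b y <= n%:R] : set PX) := pX b n%:R.
  rewrite compact_cover => /(_ X setT (fun y => interior (ball y n.+1%:R^-1 : set PX))) [].
  - by move=> y _; exact: open_interior.
  - by move=> x _; exists x => //; exact: (@nbhsx_ballx R X).
  - move=> D _ DK; exists (finmap.enum_fset D) => x /DK [y /= yD].
    move=> /(@interior_subset PX); rewrite (@ballEmdist R X) /= => yx.
    by exists y.
have [D HD] := choice net.
exists (fun k => let p := odflt (0%N, 0%N) (unpickle k) in nth b (D p.1) p.2) => x e e0.
have [n [nx ne]] : exists n : nat, mdist b x <= n%:R /\ n.+1%:R^-1 < e.
  near \oo => n; exists n; split.
    by near: n; exact: nbhs_infty_ger.
  by near: n; exact: near_infty_natSinv_lt (PosNum e0).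
have [y yD yx] := HD n x nx.
exists (pickle (n, index y (D n))); rewrite pickleK /= nth_index //.
exact: lt_trans ne.
Unshelve. all: by end_near. Qed.

Variables (b : X) (z : nat -> X).

(** Both properties pass from the functions h(x) to their pointwise limits; together
    they give a common bound d(., b) and a common modulus of continuity. *)
Definition normalized (f : X -> R) : Prop := f b = 0 /\ lip1 f.

Lemma normalized_le_mdist (f : X -> R) x : normalized f -> `|f x| <= mdist x b.
Proof. by move=> [fb lf]; have := lip1_norm x b lf; rewrite fb subr0. Qed.

(** The factor 1 + d(z_k,b) compensates the growth of normalized functions, so that
    the series below is dominated by a geometric one. *)
Definition weight (k : nat) : R := (2 ^+ k.+1)^-1 / (1 + mdist (z k) b).

Lemma weight_gt0 k : 0 < weight k.
Proof.
by rewrite divr_gt0 ?invr_gt0 ?exprn_gt0// ltr_pwDl// mdist_ge0.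
Qed.

Definition potential (f : X -> R) : R :=
  limn (series (fun k => weight k * f (z k))).

Lemma normalized_weight_le (f : X -> R) k : normalized f ->
  `|weight k * f (z k)| <= (2 ^+ k.+1)^-1.
Proof.
move=> nf; rewrite normrM (gtr0_norm (weight_gt0 k)) /weight.
have d0 := mdist_ge0 (z k) b.
rewrite -mulrA ler_piMr ?invr_ge0 ?exprn_ge0//.
rewrite mulrC ler_pdivrMr ?mul1r; last by lra.
by have := normalized_le_mdist (z k) nf; lra.
Qed.

Lemma cvg_series_half :
  series (fun k => (2 ^+ k.+1)^-1 : R) @ \oo --> (1 : R).
Proof.
have := cvg_geometric_series_half (1 : R) 0; rewrite expr0 divr1.
by under [in X in X -> _]eq_fun do rewrite addn1 natrX div1r.
Qed.

Lemma is_cvg_potential (f : X -> R) : normalized f ->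
  cvgn (series (fun k => weight k * f (z k))).
Proof.
move=> nf; apply: normed_cvg.
apply: (@series_le_cvg _ _ (fun k => (2 ^+ k.+1)^-1)) => [k|k|k|].
- exact: normr_ge0.
- by rewrite invr_ge0 exprn_ge0.
- exact: normalized_weight_le.
- by apply: cvgP; exact: cvg_series_half.
Qed.

(** All terms of the series for the difference are nonnegative, so each of them is
    at most the sum. *)
Lemma potential_weight_le (f g : X -> R) k : normalized f -> normalized g ->
  (forall x, f x <= g x) ->
  weight k * (g (z k) - f (z k)) <= potential g - potential f.
Proof.
move=> nf ng fg.
rewrite /potential -lim_seriesB; [|exact: is_cvg_potential..].
set u := fun k => weight k * (g (z k) - f (z k)).
rewrite (_ : (fun k => _) - (fun k => _) = u); last first.
  by apply/funext => i; rewrite /u mulrBr.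
have u0 i : 0 <= u i by rewrite mulr_ge0 ?subr_ge0// ltW// weight_gt0.
have cu : cvgn (series u).
  have := is_cvg_seriesB (is_cvg_potential ng) (is_cvg_potential nf).
  rewrite (_ : (fun k => _) - (fun k => _) = u)//.
  by apply/funext => i; rewrite /u mulrBr.
apply: (@le_trans _ _ (series u k.+1)).
  by rewrite seriesEnat /= big_nat_recr //= lerDr sumr_ge0.
apply: nondecreasing_cvgn_le => //.
by apply/nondecreasing_seqP => i; rewrite !seriesEnat /= big_nat_recr //= lerDl.
Qed.

Lemma potential_le (f g : X -> R) : normalized f -> normalized g ->
  (forall x, f x <= g x) -> potential f <= potential g.
Proof.
move=> nf ng fg; rewrite -subr_ge0; apply: le_trans (potential_weight_le 0 nf ng fg).
by rewrite mulr_ge0 ?subr_ge0// ltW// weight_gt0.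
Qed.

(** Dominated convergence: beyond a rank N the tails are small uniformly in i, and
    the first N terms converge. *)
Lemma cvg_potential {T} (F : set_system T) (u : T -> X -> R) (g : X -> R)
    {FF : Filter F} : (forall i, normalized (u i)) -> normalized g ->
  (forall x, u i x @[i --> F] --> g x) -> potential (u i) @[i --> F] --> potential g.
Proof.
move=> nu ng ug; apply/cvgrPdist_le => e e0.
(* The terms of g and of u i are each dominated by 2^-(k+1), hence the factor 2. *)
have [N Ne] : exists N : nat, 2 * (1 - series (fun k => (2 ^+ k.+1)^-1 : R) N) <= e / 2.
  have e4 : 0 < e / 4 by lra.
  move/cvgrPdist_le : cvg_series_half => /(_ _ e4) H.
  near \oo => N; exists N.
  have : `|1 - series (fun k => (2 ^+ k.+1)^-1 : R) N| <= e / 4 by near: N.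
  by rewrite ler_norml; lra.
have cN : series (fun k => weight k * (g (z k) - u i (z k))) N @[i --> F] --> (0 : R).
  elim: (N) => [|n IH].
    by under eq_fun do rewrite seriesEnat /= big_geq//; exact: cvg_cst.
  under eq_fun do rewrite seriesEnat /= big_nat_recr //=.
  have := cvgD IH (cvgM (cvg_cst (weight n)) (cvgB (cvg_cst (g (z n))) (ug (z n)))).
  by rewrite subrr mulr0 addr0; apply; exact: FF.
have e2 : 0 < e / 2 by lra.
move/cvgrPdist_le : cN => /(_ _ e2); apply: filterS => i.
rewrite sub0r normrN => iN.
rewrite /potential -lim_seriesB; [|exact: is_cvg_potential..].
set a := (X in series X).
have aE k : a k = weight k * (g (z k) - u i (z k)) by rewrite /a mulrBr.
have ca : cvgn (series a).
  exact: is_cvg_seriesB (is_cvg_potential ng) (is_cvg_potential (nu i)).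
have bnd n : (N <= n)%N -> `|series a n| <= e.
  move=> Nn.
  have -> : series a n = series a N + \sum_(N <= k < n) a k.
    by rewrite !seriesEnat /= -big_cat_nat.
  have iN' : `|series a N| <= e / 2.
    by rewrite (_ : series a N = series (fun k => weight k * (g (z k) - u i (z k))) N)//;
      rewrite !seriesEnat /=; apply: eq_bigr => k _; exact: aE.
  have tail : `|\sum_(N <= k < n) a k| <= \sum_(N <= k < n) 2 * (2 ^+ k.+1)^-1.
    apply: le_trans (ler_norm_sum _ _ _) _; apply: ler_sum => k _.
    rewrite /a; apply: le_trans (ler_normB _ _) _.
    rewrite mulr_natl mulr2n; apply: lerD; exact: normalized_weight_le.
  have Sn : series (fun k => (2 ^+ k.+1)^-1 : R) n <= 1.
    have H := cvg_series_half; rewrite -[leRHS](cvg_lim (@Rhausdorff R) H).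
    apply: nondecreasing_cvgn_le; last exact: (cvgP _ H).
    apply/nondecreasing_seqP => m; rewrite !seriesEnat /= big_nat_recr //=.
    by rewrite lerDl invr_ge0 exprn_ge0.
  have SS : series (fun k => (2 ^+ k.+1)^-1 : R) n =
     series (fun k => (2 ^+ k.+1)^-1 : R) N + \sum_(N <= k < n) (2 ^+ k.+1)^-1.
    by rewrite !seriesEnat /= -big_cat_nat.
  rewrite -mulr_sumr in tail.
  apply: le_trans (ler_normD _ _) _; lra.
rewrite ler_norml; apply/andP; split.
  apply: limr_ge => //; near=> n.
  have : `|series a n| <= e by apply: bnd; near: n; exact: nbhs_infty_ge.
  by rewrite ler_norml => /andP[].
apply: limr_le => //; near=> n.
have : `|series a n| <= e by apply: bnd; near: n; exact: nbhs_infty_ge.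
by rewrite ler_norml => /andP[].
Unshelve. all: by end_near. Qed.

Hypothesis z_dense : forall x (e : R), 0 < e -> exists k, mdist (z k) x < e.

(** Equal potentials force equality on the dense sequence, by
    [potential_weight_le], and then everywhere by the Lipschitz bound. *)
Lemma potential_inj (f g : X -> R) : normalized f -> normalized g ->
  (forall x, f x <= g x) -> potential g <= potential f -> f =1 g.
Proof.
move=> nf ng fg gf x; apply/eqP; rewrite eq_le fg /=.
apply/ler_addgt0Pl => e e0.
have e2 : 0 < e / 2 by lra.
have [k kx] := z_dense x e2.
have := le_trans (potential_weight_le k nf ng fg) _ => /(_ 0).
rewrite subr_le0 pmulr_rle0 ?weight_gt0// => /(_ gf) gfk.
have h1 := nf.2 (z k) x; have h2 := ng.2 x (z k).
rewrite metric_sym in h2; lra.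
Qed.

Lemma cvg_normalized_dense {T} (F : set_system T) (u : T -> X -> R) (g : X -> R)
    {FF : Filter F} : (forall i, normalized (u i)) -> normalized g ->
  (forall k, u i (z k) @[i --> F] --> g (z k)) -> forall x, u i x @[i --> F] --> g x.
Proof.
move=> nu ng ug x; apply/cvgrPdist_le => e e0.
have e3 : 0 < e / 3 by lra.
have [k kx] := z_dense x e3.
move/cvgrPdist_le : (ug k) => /(_ _ e3); apply: filterS => i.
have h1 := lip1_norm (z k) x ng.2; have h2 := lip1_norm (z k) x (nu i).2.
move: h1 h2; rewrite !ler_norml.
move=> /andP[a1 a2] /andP[b1 b2] /andP[c1 c2]; apply/andP; split; lra.
Qed.

End Potential.

(** * Geodesics and steepest descent *)

Section Geodesics.
Context {R : realType} {X : metricType R}.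

Lemma geodesic_lineE (l : R -> X) :
  geodesic_line l <-> forall s t, mdist (l s) (l t) = `|s - t|.
Proof. by split=> [H s t|H s t _ _]; [apply: H|]. Qed.

Lemma geodesic_rayE (b : X) (g : R -> X) : geodesic_ray b g <->
  (forall s t : R, 0 <= s -> 0 <= t -> mdist (g s) (g t) = `|s - t|) /\ g 0 = b.
Proof.
split=> -[H g0]; split=> // s t.
  by move=> s0 t0; apply: H; rewrite in_itv /= andbT.
by rewrite !in_itv /= !andbT; exact: H.
Qed.

(** Glue l on the negative side to g on the positive side. The drop of f between
    a point of l and a point of g equals the length of the glued path, and f is
    1-Lipschitz, so the glued path is a geodesic line. It shares the segment [-1, 0]
    with l, so straightness identifies it with l. *)
Lemma directed_ray_unique (f : X -> R) (b : X) (l g : R -> X) :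
  straight X -> lip1 f -> geodesic_line l -> l 0 = b -> geodesic_ray b g ->
  (forall t, f (l t) - f (l 0) = - t) ->
  (forall t : R, 0 <= t -> f (g t) - f (l 0) = - t) ->
  {in `[0, +oo[, l =1 g}.
Proof.
move=> sX lf /geodesic_lineE Hl l0 /geodesic_rayE [Hg g0] fl fg.
pose c (t : R) := if t <= 0 then l t else g t.
have lg (s t : R) : s <= 0 -> 0 <= t -> mdist (l s) (g t) = t - s.
  move=> s0 t0; apply/eqP; rewrite eq_le; apply/andP; split.
    apply: le_trans (metric_triangle (l s) b (g t)) _.
    by rewrite -{1}l0 -g0 Hl Hg// sub0r subr0 normrN ler0_norm// ger0_norm//; lra.
  by apply: le_trans (lf _ _); have := fl s; have := fg t t0; lra.
have cl : geodesic_line c.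
  apply/geodesic_lineE => s t; rewrite /c.
  case: (leP s 0) => s0; case: (leP t 0) => t0.
  - exact: Hl.
  - by rewrite lg// ?(ltW t0)// distrC ger0_norm//; lra.
  - by rewrite metric_sym lg// ?(ltW s0)// ger0_norm//; lra.
  - by apply: Hg; exact: ltW.
(* Both l and c extend the restriction of l to [-1, 0]. *)
have [|m [_ mu]] := sX (-1) 0 l (ltrN10 R); first by move=> s t _ _; exact: Hl.
have ml : m = l by apply: mu; split=> //; apply/geodesic_lineE.
have mc : m = c.
  apply: mu; split=> // t; rewrite in_itv /= => /andP[_ t0].
  by rewrite /c t0.
move=> t; rewrite in_itv /= andbT => t0.
rewrite -ml mc /c; case: ifPn => // t0'.
have -> : t = 0 by apply/eqP; rewrite eq_le t0 t0'.
by rewrite l0 g0.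
Qed.

(** A constant map serves for the degenerate pair x = b. *)
Lemma geodesic_between_ex (b x : X) : uniquely_geodesic X ->
  exists g : R -> X, geodesic_between b x g.
Proof.
move=> uX; have [->|bx] := eqVneq b x; last by have [g] := uX b x bx; exists g.
exists (fun=> x); split=> // s t.
by rewrite !in_itv /= !mdistxx => /le_anti <- /le_anti <-; rewrite subrr normr0.
Qed.

End Geodesics.

(** * Functions h(x) and their ultralimits *)

Section Horo.
Context {R : realType} {X : metricType R} (b : X).

Lemma horo_normalized (x : X) : normalized b (horo b x).
Proof.
split=> [|y z]; first by rewrite /CX_fun /= /mkcts /horo_fun subrr.
by have := metric_triangle x z y; rewrite (metric_sym z y) /CX_fun /= /mkcts /horo_fun; lra.
Qed.

Lemma horoE (x z : X) : horo b x z = mdist x z - mdist x b.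
Proof. by []. Qed.

Lemma horo_dist (y y' z : X) : `|horo b y z - horo b y' z| <= 2 * mdist y y'.
Proof.
rewrite !horoE.
have := metric_triangle y y' z; have := metric_triangle y' y z.
have := metric_triangle y y' b; have := metric_triangle y' y b.
by rewrite (metric_sym y' y) ler_norml => *; apply/andP; split; lra.
Qed.

Lemma cvg_mdist_lt {T} (F : set_system T) (u : T -> X) (p : X) {FF : Filter F} :
  u @ F --> p -> forall e : R, 0 < e -> F [set i | mdist p (u i) < e].
Proof. by move=> up e e0; exact: (up _ (nbhs_mdist_lt p e0)). Qed.

Lemma cvg_horo {T} (F : set_system T) (u : T -> X) (p : X) {FF : Filter F} :
  u @ F --> p -> forall z, horo b (u i) z @[i --> F] --> horo b p z.
Proof.
move=> up z; apply/cvgrPdist_le => e e0.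
have e2 : 0 < e / 2 by lra.
apply: filterS (cvg_mdist_lt up e2) => i /= h.
by apply: le_trans (horo_dist _ _ _) _; lra.
Qed.

(** By the triangle inequality, moving from g s to g t changes the distance to z by
    at most t - s, while the normalizing term d(g s, b) = s grows by exactly t - s. *)
Lemma horo_geodesic_le (g : R -> X) (s t : R) : g 0 = b ->
  geodesic `[0, t] g -> 0 <= s <= t ->
  forall z, horo b (g t) z <= horo b (g s) z.
Proof.
move=> g0 Hg /andP[s0 st] z; rewrite !horoE -g0.
have t0 : 0 <= t by lra.
rewrite !Hg ?in_itv /= ?lexx ?s0 ?st ?t0//.
have := metric_triangle (g t) (g s) z.
rewrite Hg ?in_itv /= ?lexx ?s0 ?st ?t0// !subr0 !ger0_norm//; lra.
Qed.

(** An ultrafilter decides, for each neighborhood of a cluster point, whether it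
    contains the preimage; the negative answer contradicts clustering. *)
Lemma ultra_compact_cvg {T} {V : topologicalType} (F : set_system T) (u : T -> V) (K : set V) :
  UltraFilter F -> compact K -> F (u @^-1` K) -> exists p : V, u @ F --> p.
Proof.
move=> UF cK FK; have [p [_ clp]] := cK (u @ F) _ FK.
exists p => U Up; have [//|FU] := in_ultra_setVsetC (u @^-1` U) UF.
by have [q []] := clp (~` U) U FU Up.
Qed.

Lemma cvg_normalized {T} (F : set_system T) (u : T -> X -> R) (g : X -> R) {FF : ProperFilter F} :
  (forall i, normalized b (u i)) -> (forall z, u i z @[i --> F] --> g z) -> normalized b g.
Proof.
move=> nu ug; split.
  have := ug b; under eq_fun do rewrite (nu _).1.
  by move=> /(cvg_lim (@Rhausdorff R)) <-; rewrite lim_cst.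
move=> y z; have h : (u i y - u i z) @[i --> F] --> g y - g z by exact: cvgB.
rewrite -(cvg_lim (@Rhausdorff R) h); apply: limr_le; first exact: cvgP h.
by near=> i; exact: (nu i).2.
Unshelve. all: by end_near. Qed.

(** Compactness of the horofunction compactification, in the form of ultralimits:
    at each z the values h(y)(z) stay in the segment [-d(z,b), d(z,b)]. *)
Lemma ultra_horo_cvg {T} (F : set_system T) (y : T -> X) : UltraFilter F ->
  exists f : CX X, normalized b f /\ forall z, horo b (y i) z @[i --> F] --> f z.
Proof.
move=> UF.
have /choice [f Hf] : forall z, exists l : R, horo b (y i) z @[i --> F] --> l.
  move=> z; apply: (@ultra_compact_cvg _ _ _ _ `[- mdist z b, mdist z b]) => //.
    exact: segment_compact.
  apply: (filterS (P := setT)); last exact: filterT.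
  move=> i _ /=; rewrite in_itv /= -ler_norml.
  exact: normalized_le_mdist (horo_normalized _).
have nf : normalized b f.
  by apply: cvg_normalized Hf => i; exact: horo_normalized.
by exists (lip_CX nf.2).
Qed.

End Horo.

(** * The boundary, its fibers and Busemann functions *)

Section Boundary.
Context {R : realType} {X : metricType R} (b : X).
Hypothesis X_straight : straight X.

(** Working with an ultrafilter on X itself makes every bounded real function
    of x converge, with no extraction of subsequences. *)
Lemma compactification_ultra (xi : CX X) : horo_compactification b xi ->
  exists2 F : set_system X, UltraFilter F & horo b @ F --> xi.
Proof.
move=> cxi.
pose G := filter_from (nbhs xi) (fun U => horo b @^-1` U).
have PG : ProperFilter G.
  apply: filter_from_proper.
    apply: filter_from_filter; first by exists setT; exact: filterT.
    by move=> U V nU nV; exists (U `&` V); first exact: filterI.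
  by move=> U nU; have [_ [[x _ <-] Ux]] := cxi U nU; exists x.
have [F [UF GF]] := ultraFilterLemma PG.
by exists F => // U nU; apply: GF; exists U.
Qed.

Lemma compactification_normalized (xi : CX X) :
  horo_compactification b xi -> normalized b xi.
Proof.
move=> /compactification_ultra[F UF Fxi].
apply: (@cvg_normalized _ _ b _ F (horo b)); first exact: horo_normalized.
by move=> z; exact: CX_cvg_pointwise.
Qed.

Lemma directed_by_eq (xi : CX X) (g h : R -> X) : geodesic_ray b h ->
  {in `[0, +oo[, g =1 h} -> directed_by b xi g -> directed_by b xi h.
Proof.
move=> hray gh [_ [l [ll lg lxi]]]; split=> //; exists l; split=> // t t0.
by rewrite lg// gh.
Qed.

(** The default value in the definition of [Pi] is a constant map, which cannot
    agree with a geodesic ray, so a fiber element really has a direction. *)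
Lemma fiber_directed (xi : CX X) (g : R -> X) : geodesic_ray b g ->
  Pi_fiber b g xi -> directed_by b xi g.
Proof.
move=> gray [_ Pg]; apply: (directed_by_eq gray Pg).
have [[h Hh]|noh] := pselect (exists h, directed_by b xi h).
  exact: (@xgetPex _ _ [set h | directed_by b xi h]) (ex_intro _ h Hh).
exfalso; move: Pg; rewrite /Pi xgetPN; last by move=> h Hh; apply: noh; exists h.
move=> Pg; move/geodesic_rayE : gray => [Hg g0].
have := Hg 0 1 (lexx _) ler01; rewrite g0 -(Pg 1) ?in_itv /= ?ler01//.
by rewrite mdistxx sub0r normrN normr1 => /eqP; rewrite eq_sym oner_eq0.
Qed.

Lemma directed_Pi (xi : CX X) (g : R -> X) : normalized b xi ->
  directed_by b xi g -> {in `[0, +oo[, Pi b xi =1 g}.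
Proof.
move=> [_ lxi] dg.
have [hray [m [ml mh mxi]]] : directed_by b xi (Pi b xi).
  exact: (@xgetPex _ _ [set h | directed_by b xi h]) (ex_intro _ g dg).
case: dg => gray [l [ll lg lx]].
have in0 : (0 : R) \in `[0, +oo[ by rewrite in_itv /= lexx.
have l0 : l 0 = b by rewrite lg//; case: gray.
have m0 : m 0 = b by rewrite mh//; case: hray.
move=> t t0; rewrite -(lg t t0); apply/esym; move: t t0.
apply: (directed_ray_unique X_straight lxi ll l0 hray lx) => t t0.
by rewrite -mh ?in_itv /= ?t0// l0 -m0 mxi.
Qed.

(** Along its line xi tends to -oo, whereas h(y) is bounded below by -d(y,b). *)
Lemma directed_boundary (xi : CX X) (g : R -> X) :
  horo_compactification b xi -> directed_by b xi g -> horo_boundary b xi.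
Proof.
move=> cxi [_ [l [_ _ lxi]]]; split=> // -[y _ yxi].
pose t := mdist y (l 0) + 1.
by have := lxi t; have := mdist_ge0 y (l t); rewrite -yxi !horoE /t; lra.
Qed.

Lemma fiber_of_directed (xi : CX X) (g : R -> X) :
  horo_compactification b xi -> directed_by b xi g -> Pi_fiber b g xi.
Proof.
move=> cxi dxi; split; first exact: directed_boundary dxi.
by apply: directed_Pi => //; exact: compactification_normalized.
Qed.

(** The functions h(g t) decrease in t, so their limit along any ultrafilter finer
    than the neighborhoods of +oo is their limit, and it bounds them from below. *)
Lemma busemann_cvg (g : R -> X) : geodesic_ray b g ->
  [/\ normalized b (busemann b g),
      (forall z, horo b (g t) z @[t --> +oo] --> busemann b g z) &
      forall (s : R) z, 0 <= s -> busemann b g z <= horo b (g s) z].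
Proof.
move=> gray; have /geodesic_rayE[Hg g0] := gray.
have mono (s t : R) z : 0 <= s <= t -> horo b (g t) z <= horo b (g s) z.
  move=> st; apply: horo_geodesic_le => // u v.
  by rewrite !in_itv /= => /andP[u0 _] /andP[v0 _]; exact: Hg.
have [U [UU sU]] := ultraFilterLemma (@proper_pinfty_nbhs R).
have [B [nB UB]] := ultra_horo_cvg b g UU.
have leB (s : R) z : 0 <= s -> B z <= horo b (g s) z.
  move=> s0; apply: (ler_cvg_to (UB z) (cvg_cst _)).
  by apply: sU; exists s; split; rewrite ?num_real// => t st; apply: mono; rewrite s0 ltW.
have cB z : horo b (g t) z @[t --> +oo] --> B z.
  apply/cvgrPdist_le => e e0.
  move/cvgrPdist_le : (UB z) => /(_ _ e0) He.
  have [s [s0 se]] : exists s : R, 0 <= s /\ `|B z - horo b (g s) z| <= e.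
    have h0 : U [set s | 0 <= s].
      by apply: sU; exists 0; split; rewrite ?num_real// => t /ltW.
    by have [s [? ?]] := filter_ex (filterI h0 He); exists s.
  exists s; split; rewrite ?num_real// => t /= st.
  have h1 := leB t z (le_trans s0 (ltW st)).
  have h2 : horo b (g t) z <= horo b (g s) z by apply: mono; rewrite s0 ltW.
  move: h1 h2 se; rewrite !ler_norml => h1 h2 /andP[? ?]; apply/andP; split; lra.
have -> : busemann b g = B.
  apply: (@cvg_lim _ (@CX_hausdorff R X)).
  by apply: CX_cvg_lip1 => // [t|]; [exact: (horo_normalized b (g t)).2|exact: nB.2].
by [].
Qed.

(** The distance from b to x tends to infinity, since h(x) >= -d(x,b) while xi is
    unbounded below. By properness G x s has a limit along F for every s >= 0,
    and these limits form a ray from b. As h(x) decreases at unit speed along G x, so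
    does xi along the limit ray, which [directed_ray_unique] identifies with gamma. *)
Lemma geodesics_cvg_ray (F : set_system X) (G : X -> R -> X) (xi : CX X) (gamma : R -> X) :
  proper_space X -> UltraFilter F -> (forall z, horo b x z @[x --> F] --> xi z) ->
  (forall x, geodesic_between b x (G x)) -> directed_by b xi gamma ->
  forall s : R, 0 <= s -> F [set x | s <= mdist b x] /\ G x s @[x --> F] --> gamma s.
Proof.
move=> X_proper UF Fxi HG [gray [l [ll lg lxi]]].
have nxi : normalized b xi.
  by apply: cvg_normalized Fxi => x; exact: horo_normalized.
have in0 : (0 : R) \in `[0, +oo[ by rewrite in_itv /= lexx.
have l0 : l 0 = b by rewrite lg//; case: gray.
have xil t : xi (l t) = - t by rewrite -lxi l0 nxi.1 subr0.
(* Evaluate xi at l (s + 1), with tolerance 1. *)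
have far s : F [set x | s <= mdist b x].
  move/cvgrPdist_le : (Fxi (l (s + 1))) => /(_ _ ltr01); apply: filterS => x /=.
  rewrite xil horoE ler_norml => /andP[h _].
  by have := mdist_ge0 x (l (s + 1)); rewrite (metric_sym b); lra.
have dG x (s t : R) : 0 <= s -> 0 <= t -> s <= mdist b x -> t <= mdist b x ->
    mdist (G x s) (G x t) = `|s - t|.
  by move=> s0 t0 sx tx; have [gG _ _] := HG x; apply: gG; rewrite in_itv /= ?s0 ?t0.
have /choice [h Hh] : forall s : R, exists p : X, 0 <= s -> G x s @[x --> F] --> p.
  move=> s; have [s0|s0] := leP 0 s; last by exists b.
  have [|p Hp] := @ultra_compact_cvg _ _ F (fun x => G x s) _ UF (X_proper b s); last by exists p.
  apply: filterS (far s) => x /= sx.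
  have [gG G0 _] := HG x; rewrite -[X in mdist X _]G0 dG//; last exact: mdist_ge0.
  by rewrite sub0r normrN ger0_norm.
(* Distances pass to the limit: compare h s, h t with G x s, G x t for one good x. *)
have hray : geodesic_ray b h.
  apply/geodesic_rayE; split.
    move=> s t s0 t0; apply/eqP/negP/negP; rewrite eq_sym -subr_eq0 -normr_le0.
    apply/ler_addgt0Pr => e e0; rewrite add0r.
    have e2 : 0 < e / 2 by lra.
    have [x [[sx tx] [hs ht]]] : exists x, (s <= mdist b x /\ t <= mdist b x) /\
        (mdist (h s) (G x s) < e / 2 /\ mdist (h t) (G x t) < e / 2).
      apply: (@filter_ex _ F); apply: filterI; first exact: (filterI (far s) (far t)).
      apply: filterI.
        exact: (cvg_mdist_lt (Hh s s0) e2).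
      exact: (cvg_mdist_lt (Hh t t0) e2).
    rewrite -(dG x s t)//.
    have := metric_triangle (G x s) (h s) (G x t).
    have := metric_triangle (h s) (h t) (G x t).
    have := metric_triangle (h s) (G x s) (h t).
    have := metric_triangle (G x s) (G x t) (h t).
    rewrite (metric_sym (G x s) (h s)) (metric_sym (G x t) (h t)).
    by rewrite ler_norml => *; apply/andP; split; lra.
  apply: (@mdist_positivity R X); apply/eqP; rewrite eq_le mdist_ge0 andbT.
  apply/ler_addgt0Pl => e e0; rewrite addr0.
  have [x] := @filter_ex _ F _ _ (cvg_mdist_lt (Hh 0 (lexx 0)) e0).
  by have [_ G0 _] := HG x; rewrite /= G0; exact: ltW.
have xih (t : R) : 0 <= t -> xi (h t) - xi (l 0) = - t.
  move=> t0; rewrite l0 nxi.1 subr0.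
  rewrite -(cvg_lim (@Rhausdorff R) (Fxi (h t))).
  apply: cvg_lim; first exact: Rhausdorff.
  apply/cvgrPdist_le => e e0.
  apply: filterS (filterI (far t) (cvg_mdist_lt (Hh t t0) e0)) => x /= [tx ht].
  have := lip1_norm (h t) (G x t) (horo_normalized b x).2.
  have -> : horo b x (G x t) = - t.
    have [_ _ G1] := HG x.
    have -> : horo b x (G x t) = mdist (G x (mdist b x)) (G x t) - mdist b x.
      by rewrite G1 (metric_sym b).
    by rewrite dG ?mdist_ge0// ger0_norm; lra.
  by rewrite distrC => k; apply: le_trans k _; exact: ltW.
move=> s s0; split; first exact: far.
have sin : s \in `[0, +oo[ by rewrite in_itv /= s0.
rewrite -lg// (directed_ray_unique X_straight nxi.2 ll l0 hray lxi xih)//.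
exact: Hh.
Qed.

End Boundary.

(** * The limit chain, parametrized by its potential *)

Section LevelPath.
Context {R : realType} {X : metricType R} (b : X) (z : nat -> X).
Hypothesis z_dense : forall x (e : R), 0 < e -> exists k, mdist (z k) x < e.
Variables (F : set_system X) (G : X -> R -> X) (xi : CX X).
Hypotheses (UF : UltraFilter F)
  (Fxi : forall y, horo b x y @[x --> F] --> xi y)
  (HG : forall x, geodesic_between b x (G x)).

Notation Phi := (potential b z).

Lemma chain_end_normalized : normalized b xi.
Proof. by apply: cvg_normalized Fxi => x; exact: horo_normalized. Qed.

Lemma horo_chain_le x s t : 0 <= s <= t -> t <= mdist b x ->
  forall y, horo b (G x t) y <= horo b (G x s) y.
Proof.
move=> st tx; have [gG G0 _] := HG x; apply: horo_geodesic_le => // u v.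
rewrite !in_itv /= => /andP[u0 ut] /andP[v0 vt]; apply: gG; rewrite in_itv /=.
  by rewrite u0 (le_trans ut).
by rewrite v0 (le_trans vt).
Qed.

(** Points of one chain are comparable, so the order of their potentials
    determines the order of the functions. *)
Lemma horo_chain_potential_le x s t : 0 <= s <= mdist b x -> 0 <= t <= mdist b x ->
  Phi (horo b (G x s)) <= Phi (horo b (G x t)) ->
  forall y, horo b (G x s) y <= horo b (G x t) y.
Proof.
move=> /andP[s0 sx] /andP[t0 tx] Pst y.
have [ts|st] := leP t s; first by apply: horo_chain_le => //; rewrite t0.
have H : forall y, horo b (G x t) y <= horo b (G x s) y.
  by apply: horo_chain_le => //; rewrite s0 ltW.
by rewrite (potential_inj z_dense (horo_normalized b _) (horo_normalized b _) H Pst y).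
Qed.

(** Intermediate value theorem along G x. The level v is truncated to the interval
    between the potentials of h(x) and h(b), which makes it attained for every real v. *)
Lemma level_reached x v : exists s, 0 <= s <= mdist b x /\
  Phi (horo b (G x s)) = Num.max (Phi (horo b x)) (Num.min v (Phi (horo b b))).
Proof.
have [gG G0 G1] := HG x; have d0 := mdist_ge0 b x.
have xb : Phi (horo b x) <= Phi (horo b b).
  apply: potential_le; try exact: horo_normalized.
  move=> y; rewrite !horoE mdistxx subr0 (metric_sym x b).
  by have := metric_triangle x b y; rewrite (metric_sym x b); lra.
have [||s] := @IVT R (fun s => Phi (horo b (G x s))) 0 (mdist b x)
    (Num.max (Phi (horo b x)) (Num.min v (Phi (horo b b)))) d0.
- apply/subspace_continuousP => s; rewrite /= in_itv /= => sx.
  apply: cvg_potential; try by move=> *; exact: horo_normalized.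
  apply: cvg_horo; apply/metricType_numDomainType.cvgrPdist_lt => e e0.
  rewrite near_withinE; apply: filterS (nbhsx_ballx s e e0) => t /= st tx.
  by rewrite gG// in_itv.
- rewrite G0 G1 (min_r xb) (max_l xb) le_max lexx /= ge_max xb /=.
  by rewrite ge_min lexx orbT.
by rewrite in_itv /= => sx <-; exists s.
Qed.

(** q v x is the time at which the chain of x has level v, and eta v is the limit of
    these points. The map v |-> max a (min v c) is nondecreasing and 1-Lipschitz
    whatever a and c are, so both properties survive the limit along F; with
    [potential_weight_le] they give the continuity of eta. *)
Lemma level_path : exists (q : R -> X -> R) (eta : R -> CX X),
  [/\ forall v x, 0 <= q v x <= mdist b x,
      forall v, normalized b (eta v),
      forall v y, horo b (G x (q v x)) y @[x --> F] --> eta v y,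
      forall v, Phi (eta v) = Num.max (Phi xi) (Num.min v (Phi (horo b b))) &
      continuous eta].
Proof.
have /choice [q] : forall v, exists q : X -> R, forall x, 0 <= q x <= mdist b x /\
    Phi (horo b (G x (q x))) = Num.max (Phi (horo b x)) (Num.min v (Phi (horo b b))).
  by move=> v; have [q Hq] := choice (level_reached^~ v); exists q.
move=> Hq.
have /choice [eta] : forall v, exists f : CX X, normalized b f /\
    forall y, horo b (G x (q v x)) y @[x --> F] --> f y.
  by move=> v; exact: (ultra_horo_cvg b (fun x => G x (q v x)) UF).
move=> Heta.
have Peta v : Phi (eta v) = Num.max (Phi xi) (Num.min v (Phi (horo b b))).
  have h : Phi (horo b (G x (q v x))) @[x --> F] --> Phi (eta v).
    apply: cvg_potential; [|exact: (Heta v).1|exact: (Heta v).2].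
    by move=> x; exact: horo_normalized.
  rewrite -(cvg_lim (@Rhausdorff R) h); apply: cvg_lim; first exact: Rhausdorff.
  have : Phi (horo b x) @[x --> F] --> Phi xi.
    by apply: cvg_potential => //; [move=> x; exact: horo_normalized|exact: chain_end_normalized].
  move=> /cvgrPdist_le H; apply/cvgrPdist_le => e e0.
  apply: filterS (H e e0) => x; rewrite (Hq v x).2.
  set m := Num.min _ _; rewrite !ler_norml => /andP[h1 h2].
  by case: (leP (Phi xi) m); case: (leP (Phi (horo b x)) m) => *; apply/andP; split; lra.
have clamp (a c v w : R) : v <= w ->
    0 <= Num.max a (Num.min w c) - Num.max a (Num.min v c) <= w - v.
  move=> vw; set m := Num.min v c; set n := Num.min w c.
  have : 0 <= n - m <= w - v.
    by rewrite /n /m; case: (leP v c); case: (leP w c) => *; apply/andP; split; lra.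
  by move=> /andP[h1 h2]; case: (leP a m); case: (leP a n) => *; apply/andP; split; lra.
have eta_le v w : v <= w -> forall y, eta v y <= eta w y.
  move=> vw y; apply: (ler_cvg_to ((Heta v).2 y) ((Heta w).2 y)).
  apply: filterE => x; apply: (horo_chain_potential_le (Hq v x).1 (Hq w x).1).
  rewrite (Hq v x).2 (Hq w x).2 -subr_ge0.
  by have /andP[] := clamp (Phi (horo b x)) (Phi (horo b b)) v w vw.
have eta_Phi v w : v <= w -> Phi (eta w) - Phi (eta v) <= w - v.
  by move=> vw; rewrite !Peta; have /andP[] := clamp (Phi xi) (Phi (horo b b)) v w vw.
exists q, eta; split=> //; [by move=> v x; exact: (Hq v x).1|by move=> v; exact: (Heta v).1|
  by move=> v; exact: (Heta v).2|].
move=> v; apply: CX_cvg_lip1 => [w||y]; try exact: (Heta _).1.2.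
apply: (cvg_normalized_dense z_dense (F := nbhs v) (fun w => (Heta w).1) (Heta v).1) => k.
have wk := weight_gt0 b z k.
apply/cvgrPdist_le => e e0.
have we : 0 < weight b z k * e by rewrite mulr_gt0.
apply: filterS (nbhsx_ballx v _ we) => w /=; rewrite /ball /= ltr_norml => /andP[h1 h2].
have key u u' : u <= u' -> weight b z k * (eta u' (z k) - eta u (z k)) <= u' - u.
  move=> uu; apply: le_trans (eta_Phi _ _ uu).
  by apply: (potential_weight_le z k (Heta u).1 (Heta u').1); exact: eta_le.
rewrite -(ler_pM2l wk); have [vw|wv] := leP v w.
  rewrite distrC ger0_norm ?subr_ge0 ?eta_le//.
  by apply: le_trans (key _ _ vw) _; lra.
rewrite ger0_norm ?subr_ge0 ?(eta_le _ _ (ltW wv))//.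
by apply: le_trans (key _ _ (ltW wv)) _; lra.
Qed.

End LevelPath.

(** * The path from B(gamma) to xi *)

Theorem proposition3p11 (R : realType) (X : metricType R)
    (X_proper : proper_space X) (X_geodesic : uniquely_geodesic X)
    (X_straight : straight X) (b : X) (gamma : R -> X)
    (gamma_ray : geodesic_ray b gamma) (xi : CX X)
    (xi_fiber : Pi_fiber b gamma xi) :
  exists p : R -> CX X,
    [/\ {within `[0, 1], continuous p},
        p 0 = busemann b gamma,
        p 1 = xi &
        forall t : R, t \in `[0, 1] -> Pi_fiber b gamma (p t)].
Proof.
have dxi := fiber_directed gamma_ray xi_fiber.
have [[cxi _] _] := xi_fiber.
have nxi := compactification_normalized cxi.
have [F UF Fxi] := compactification_ultra cxi.
have {}Fxi y : horo b x y @[x --> F] --> xi y by exact: CX_cvg_pointwise.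
have [z z_dense] := proper_dense_seq b X_proper.
have /choice [G HG] : forall x, exists g : R -> X, geodesic_between b x g.
  by move=> x; exact: geodesic_between_ex.
have Ggamma := geodesics_cvg_ray X_straight X_proper UF Fxi HG dxi.
have [q [eta [q_in neta eta_lim Peta eta_cont]]] := level_path z_dense UF Fxi HG.
have [nB B_lim B_le] := busemann_cvg gamma_ray.
set B := busemann b gamma in nB B_lim B_le *.
set Phi := potential b z in Peta.
have [_ [l [ll lg lxi]]] := dxi.
have l0 : l 0 = b.
  by rewrite lg; [case: gamma_ray|rewrite in_itv /= lexx].
have xil t : xi (l t) = - t by rewrite -lxi l0 nxi.1 subr0.
have xi_eta v y : xi y <= eta v y.
  apply: (ler_cvg_to (Fxi y) (eta_lim v y)); apply: filterE => x.
  have [_ _ {1}<-] := HG x.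
  by have /andP[q0 qx] := q_in v x; apply: (horo_chain_le HG) => //; rewrite q0.
have xi_gamma (s : R) y : 0 <= s -> xi y <= horo b (gamma s) y.
  move=> s0; have sin : s \in `[0, +oo[ by rewrite in_itv /= s0.
  have := nxi.2 y (l s); rewrite xil lg// horoE.
  have /geodesic_rayE[Hg g0] := gamma_ray.
  have -> : mdist (gamma s) b = s by rewrite -g0 Hg// subr0 ger0_norm.
  by rewrite metric_sym; lra.
have xi_B y : xi y <= B y.
  apply: (ler_cvg_to (cvg_cst (xi y)) (B_lim y)).
  by exists 0; split; rewrite ?num_real// => s /ltW; exact: xi_gamma.
have PB : Phi xi <= Phi B by exact: potential_le.
have PBb : Phi B <= Phi (horo b b).
  apply: potential_le => // [|y]; first exact: horo_normalized.
  by have := B_le 0 y (lexx 0); have [_ ->] := gamma_ray.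
have Peta_v v : Phi xi <= v <= Phi B -> Phi (eta v) = v.
  by move=> /andP[h1 h2]; rewrite Peta min_l ?max_r//; exact: le_trans PBb.
(* F decides whether the point of level v lies beyond or before G x s.
   In the second case h (gamma s) <= eta v, but the potential of eta v is at most that of
   B(gamma), hence at most that of h (gamma s): the two functions coincide. *)
have eta_gamma v (s : R) y : Phi xi <= v <= Phi B -> 0 <= s ->
    eta v y <= horo b (gamma s) y.
  move=> vB s0; have [far Gs] := Ggamma s s0.
  have hGs y' : horo b (G x s) y' @[x --> F] --> horo b (gamma s) y'.
    exact: cvg_horo.
  have [Fs|Fs] := in_ultra_setVsetC [set x | s <= q v x] UF.
    apply: (ler_cvg_to (eta_lim v y) (hGs y)).
    apply: filterS Fs => x /= sq; have /andP[_ qx] := q_in v x.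
    by apply: (horo_chain_le HG) => //; rewrite s0.
  have H y' : horo b (gamma s) y' <= eta v y'.
    apply: (ler_cvg_to (hGs y') (eta_lim v y')).
    apply: filterS (filterI far Fs) => x /= [sx /negP]; rewrite -ltNge => qs.
    by have /andP[q0 _] := q_in v x; apply: (horo_chain_le HG) => //; rewrite q0 ltW.
  rewrite (potential_inj z_dense (horo_normalized b _) (neta v) H)//.
  rewrite -/Phi Peta_v//; have /andP[_ /le_trans] := vB; apply.
  by apply: potential_le => // [|y']; [exact: horo_normalized|exact: B_le].
have eta_B v y : Phi xi <= v <= Phi B -> eta v y <= B y.
  move=> vB; apply: (ler_cvg_to (cvg_cst (eta v y)) (B_lim y)).
  by exists 0; split; rewrite ?num_real// => s /ltW; exact: eta_gamma.
(* Compare with h (gamma s) for s = |t|, which is at least max 0 t. *)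
have Bl t : B (l t) <= - t.
  pose s := `|t|; have s0 : 0 <= s by exact: normr_ge0.
  have := B_le s (l t) s0; rewrite -lg ?in_itv /= ?s0// horoE.
  move/geodesic_lineE : ll => Hl.
  have -> : mdist (l s) b = s by rewrite -l0 Hl subr0 ger0_norm.
  rewrite Hl.
  by rewrite ger0_norm ?subr_ge0 ?ler_norm//; lra.
have fiber v : Phi xi <= v <= Phi B -> Pi_fiber b gamma (eta v).
  move=> vB; apply: fiber_of_directed => //.
    have cv : horo b (G x (q v x)) @[x --> F] --> eta v.
      apply: CX_cvg_lip1 (eta_lim v) => [x|]; last exact: (neta v).2.
      exact: (horo_normalized b _).2.
    move=> U nU; have [x Ux] := @filter_ex _ F _ _ (cv U nU).
    by exists (horo b (G x (q v x))); split=> //; exists (G x (q v x)).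
  split=> //; exists l; split=> // t.
  rewrite l0 (neta v).1 subr0; apply/eqP; rewrite eq_le -{2}xil xi_eta andbT.
  exact: le_trans (eta_B _ _ vB) (Bl t).
pose level (t : R) := Phi B + t * (Phi xi - Phi B).
have level_in t : t \in `[0, 1] -> Phi xi <= level t <= Phi B.
  by rewrite in_itv /= /level => /andP[t0 t1]; apply/andP; split; nra.
exists (eta \o level); split.
- apply: continuous_subspaceT => t; apply: continuous_comp; last exact: eta_cont.
  by apply: cvgD; [exact: cvg_cst|apply: cvgM; [exact: cvg_id|exact: cvg_cst]].
- rewrite /= /level mul0r addr0; apply: CX_ext => y.
  have vB : Phi xi <= Phi B <= Phi B by rewrite PB lexx.
  apply: (potential_inj z_dense (neta _) nB) => [y'|]; first exact: eta_B.
  by rewrite -/Phi Peta_v.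
- rewrite /= /level mul1r addrC subrK; apply: CX_ext => y; apply/esym.
  apply: (potential_inj z_dense nxi (neta _)) => [y'|]; first exact: xi_eta.
  by rewrite -/Phi Peta_v// lexx.
- by move=> t t01; apply: fiber; exact: level_in.
Qed.
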